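(* Let $\mathcal{M}=\langle W,R,V\rangle$ be a relational model, let $w\in W$, and let $\varphi$ be a formula of bridge logic $\mathcal{ML}(\langle\mathsf{br}\rangle,\langle\mathsf{gbr}\rangle)$. Then $$\mathcal{M},w\models\varphi\quad\text{if and only if}\quad \mathcal{M},w\models(\varphi)'_{\emptyset},$$ where $(\varphi)'_\emptyset$ is the translation of $\varphi$ into the hybrid logic $\mathcal{HL}(\mathsf{E},\downarrow)$ defined in the context (taken with parameter $B=\emptyset$), and where on the right-hand side $\mathcal{M}$ is regarded as a hybrid model by letting the nominals denote arbitrary states of $W$.
   Context: Let $\mathsf{PROP}$ be a countably infinite set of propositional symbols and $\mathsf{NOM}$ a countably infinite set of nominals; formulas of bridge logic contain no nominals. **Models.** A model is $\mathcal{M}=\langle W,R,V\rangle$ with $W\neq\emptyset$, $R\subseteq W\times W$, and $V$ assigning to each $p\in\mathsf{PROP}$ a subset $V(p)\subseteq W$. A hybrid model additionally has $V$ assigning to each nominal a singleton subset of $W$. For $(v,u)\in (W\times W)\setminus R$, $\mathcal{M}^+_{vu}=\langle W,R\cup\{(v,u)\},V\rangle$. **Bridge logic** $\mathcal{ML}(\langle\mathsf{br}\rangle,\langle\mathsf{gbr}\rangle)$: formulas are $\bot\mid p\mid\neg\varphi\mid\varphi\wedge\psi\mid\Diamond\varphi\mid\langle\mathsf{br}\rangle\varphi\mid\langle\mathsf{gbr}\rangle\varphi$ with $p\in\mathsf{PROP}$. Semantics: $\bot$, $p$ (true at $w$ iff $w\in V(p)$), $\neg$, $\wedge$ as usual;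 $\mathcal{M},w\models\Diamond\varphi$ iff $\mathcal{M},v\models\varphi$ for some $v$ with $(w,v)\in R$; $\mathcal{M},w\models\langle\mathsf{br}\rangle\varphi$ iff for some $v\in W$ with $(w,v)\notin R$, $\mathcal{M}^+_{wv},v\models\varphi$; $\mathcal{M},w\models\langle\mathsf{gbr}\rangle\varphi$ iff for some $v,u\in W$ with $(v,u)\notin R$, $\mathcal{M}^+_{vu},w\models\varphi$. **Hybrid logic** $\mathcal{HL}(\mathsf{E},\downarrow)$: built from propositional symbols and nominals using $\bot,\neg,\wedge,\Diamond$, $\mathsf{E}$ and $\downarrow n.$ (for $n\in\mathsf{NOM}$). Semantics: $\bot$, $p$ (true at $w$ iff $w\in V(p)$), $\neg$, $\wedge$ have their usual meaning; $\mathcal{M},w\models\Diamond\varphi$ iff $\mathcal{M},v\models\varphi$ for some $v$ with $(w,v)\in R$; a nominal $n$ is true at $w$ iff $V(n)=\{w\}$; $\mathcal{M},w\models\mathsf{E}\varphi$ iff $\mathcal{M},v\models\varphi$ for some $v\in W$; $\langle W,R,V\rangle,w\models\,\downarrow n.\varphi$ iff $\langle W,R,V_n^w\rangle,w\models\varphi$, where $V_n^w$ agrees with $V$ except that $V_n^w(n)=\{w\}$. The satisfaction operator $n{:}\varphi$ (true iff $\varphi$ is true at the state denoted by $n$) abbreviates $\mathsf{E}(n\wedge\varphi)$. **Translation.** For finite $B\subseteq\mathsf{NOM}\times\mathsf{NOM}$ (with $nm$ shorthand for $(n,m)$ or $\{(n,m)\}$) define $$\begin{aligned} (\bot)'_B&=\bot,\quad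 (p)'_B=p,\quad (\neg\varphi)'_B=\neg(\varphi)'_B,\quad (\varphi\wedge\psi)'_B=(\varphi)'_B\wedge(\psi)'_B,\\ (\Diamond\varphi)'_B&=\ \downarrow n.\mathsf{E}\downarrow m.\big((n{:}\Diamond m\vee\mathsf{belongs}(n,B))\wedge(\varphi)'_B\big),\\ (\langle\mathsf{br}\rangle\varphi)'_B&=\ \downarrow n.\mathsf{E}\downarrow m.\big(\neg n{:}\Diamond m\wedge\neg\mathsf{belongs}(n,B)\wedge(\varphi)'_{B\cup nm}\big),\\ (\langle\mathsf{gbr}\rangle\varphi)'_B&=\ \downarrow k.\mathsf{E}\downarrow n.\mathsf{E}\downarrow m.\big(\neg n{:}\Diamond m\wedge\neg\mathsf{belongs}(n,B)\wedge k{:}(\varphi)'_{B\cup nm}\big), \end{aligned}$$ where $n,m,k$ are pairwise distinct nominals not appearing in $B$, and $\mathsf{belongs}(n,B)=\bigvee_{(x,y)\in B}(y\wedge n{:}x)$ (the empty disjunction being $\bot$). The nominals of $(\varphi)'_\emptyset$ are all bound, so its truth value does not depend on the initial denotation of the nominals. *)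

(* Defs.v *)
From mathcomp Require Import all_boot.
From mathcomp Require Import finmap.
From mathcomp Require Import boolp classical_sets functions cardinality.

Set Implicit Arguments.
Unset Strict Implicit.
Unset Printing Implicit Defensive.

Local Open Scope classical_set_scope.
Local Open Scope card_scope.

Definition countably_infinite (T : Type) : Prop := [set: T] #= [set: nat].

(* [W] is nonempty as soon as a state [w : W] is given. *)
Record model (PROP W : Type) := Model {
  rel_of : set (W * W);
  val_of : PROP -> set W }.

Definition is_singleton (W : Type) (A : set W) : Prop :=
  exists w : W, A = [set w].

Record hmodel (PROP NOM W : Type) := HModel {
  hbase :> model PROP W;
  nom_of : NOM -> set W;
  nom_ofP : forall n : NOM, is_singleton (nom_of n) }.

(* Meaningful as M^+_{vu} when (v, u) is not in the relation of M, which the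
   semantic clauses below always require. *)
Definition add_edge (PROP W : Type) (M : model PROP W) (v u : W) :
    model PROP W :=
  Model (rel_of M `|` [set (v, u)]) (val_of M).

Inductive bform (PROP : Type) : Type :=
| BBot
| BProp of PROP
| BNeg of bform PROP
| BAnd of bform PROP & bform PROP
| BDia of bform PROP
| BBr of bform PROP
| BGbr of bform PROP.

Arguments BBot {PROP}.

Fixpoint bsat (PROP W : Type) (M : model PROP W) (w : W) (phi : bform PROP)
    {struct phi} : Prop :=
  match phi with
  | BBot => False
  | BProp p => val_of M p w
  | BNeg a => ~ bsat M w a
  | BAnd a b => bsat M w a /\ bsat M w b
  | BDia a => exists v, rel_of M (w, v) /\ bsat M v a
  | BBr a => exists v, ~ rel_of M (w, v) /\ bsat (add_edge M w v) v a
  | BGbr a => exists v u, ~ rel_of M (v, u) /\ bsat (add_edge M v u) w a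
  end.

Inductive hform (PROP NOM : Type) : Type :=
| HBot
| HProp of PROP
| HNom of NOM
| HNeg of hform PROP NOM
| HAnd of hform PROP NOM & hform PROP NOM
| HDia of hform PROP NOM
| HE of hform PROP NOM
| HDown of NOM & hform PROP NOM.

Arguments HBot {PROP NOM}.
Arguments HProp {PROP NOM}.
Arguments HNom {PROP NOM}.

Section Hybrid.
Variables (PROP : Type) (NOM : choiceType) (W : Type).

Definition nom_upd (nu : NOM -> set W) (n : NOM) (w : W) : NOM -> set W :=
  fun m => if m == n then [set w] else nu m.

Lemma nom_updP (nu : NOM -> set W) (n : NOM) (w : W) :
  (forall m, is_singleton (nu m)) -> forall m, is_singleton (nom_upd nu n w m).
Proof. by move=> nuP m; rewrite /nom_upd; case: eqP => // _; exists w. Qed.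

Definition hmodel_upd (N : hmodel PROP NOM W) (n : NOM) (w : W) :
    hmodel PROP NOM W :=
  HModel (hbase N) (nom_updP n w (nom_ofP N)).

Fixpoint hsat (N : hmodel PROP NOM W) (w : W) (phi : hform PROP NOM)
    {struct phi} : Prop :=
  match phi with
  | HBot => False
  | HProp p => val_of N p w
  | HNom n => nom_of N n = [set w]
  | HNeg a => ~ hsat N w a
  | HAnd a b => hsat N w a /\ hsat N w b
  | HDia a => exists v, rel_of N (w, v) /\ hsat N v a
  | HE a => exists v, hsat N v a
  | HDown n a => hsat (hmodel_upd N n w) w a
  end.

End Hybrid.

Definition HOr (PROP NOM : Type) (a b : hform PROP NOM) : hform PROP NOM :=
  HNeg (HAnd (HNeg a) (HNeg b)).

(* n : a *)
Definition HAt (PROP NOM : Type) (n : NOM) (a : hform PROP NOM) :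
    hform PROP NOM :=
  HE (HAnd (HNom n) a).

Section Translation.
Variables (PROP NOM : choiceType).
Implicit Types (B : {fset NOM * NOM}) (n m : NOM).

Definition noms B : {fset NOM} :=
  ([fset p.1 | p in B] `|` [fset p.2 | p in B])%fset.

(* The translation leaves the choice of the nominals n, m, k unspecified; a
   [naming] is one such choice, made for every parameter B and every formula
   to be translated. *)
Record naming := Naming {
  nm_n : {fset NOM * NOM} -> bform PROP -> NOM;
  nm_m : {fset NOM * NOM} -> bform PROP -> NOM;
  nm_k : {fset NOM * NOM} -> bform PROP -> NOM;
  nm_uniq : forall B phi, uniq [:: nm_n B phi; nm_m B phi; nm_k B phi];
  nm_fresh : forall B phi,
    [/\ nm_n B phi \notin noms B,
        nm_m B phi \notin noms B &
        nm_k B phi \notin noms B] }.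

Definition belongs n B : hform PROP NOM :=
  \big[@HOr PROP NOM/HBot]_(p <- B) HAnd (HNom p.2) (HAt n (HNom p.1)).

Fixpoint translate (c : naming) B (phi : bform PROP) {struct phi} :
    hform PROP NOM :=
  let n := nm_n c B phi in
  let m := nm_m c B phi in
  let k := nm_k c B phi in
  match phi with
  | BBot => HBot
  | BProp p => HProp p
  | BNeg a => HNeg (translate c B a)
  | BAnd a b => HAnd (translate c B a) (translate c B b)
  | BDia a =>
      HDown n (HE (HDown m
        (HAnd (HOr (HAt n (HDia (HNom m))) (belongs n B))
              (translate c B a))))
  | BBr a =>
      HDown n (HE (HDown m
        (HAnd (HAnd (HNeg (HAt n (HDia (HNom m)))) (HNeg (belongs n B)))
              (translate c (B `|` [fset (n, m)])%fset a))))
  | BGbr a =>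
      HDown k (HE (HDown n (HE (HDown m
        (HAnd (HAnd (HNeg (HAt n (HDia (HNom m)))) (HNeg (belongs n B)))
              (HAt k (translate c (B `|` [fset (n, m)])%fset a)))))))
  end.

Lemma fresh_nom (NOM_inf : countably_infinite NOM) (A : {fset NOM}) :
  exists n, n \notin A.
Proof.
apply: contrapT => noA.
have NOMfin : finite_set [set: NOM].
  apply: sub_finite_set (finite_fset A) => n _ /=.
  by apply: contrapT => /negP nA; apply: noA; exists n.
apply: infinite_nat; rewrite /countably_infinite in NOM_inf.
by rewrite -(eq_finite_set NOM_inf).
Qed.

Lemma naming_exists (NOM_inf : countably_infinite NOM) : inhabited naming.
Proof.
pose f A := sval (cid (fresh_nom NOM_inf A)).
have fP A : f A \notin A by apply: svalP (cid (fresh_nom NOM_inf A)).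
clearbody f.
pose n B := f (noms B).
pose m B := f (n B |` noms B)%fset.
pose k B := f (m B |` (n B |` noms B))%fset.
have nP B : n B \notin noms B by apply: fP.
have mP B : m B \notin (n B |` noms B)%fset by apply: fP.
have kP B : k B \notin (m B |` (n B |` noms B))%fset by apply: fP.
clearbody k; clearbody m; clearbody n.
split; apply: (@Naming (fun B _ => n B) (fun B _ => m B) (fun B _ => k B)) => B _.
  have := mP B; have := kP B; rewrite /= !in_fset1U !negb_or !inE !negb_or.
  move=> /andP[km /andP[kn _]] /andP[mn _].
  by rewrite eq_sym mn eq_sym kn eq_sym km.
have := mP B; have := kP B; rewrite !in_fset1U !negb_or.
by move=> /andP[_ /andP[_ ?]] /andP[_ ?].
Qed.

End Translation.

(* Main.v *)
Require Import Defs.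
From mathcomp Require Import all_boot.
From mathcomp Require Import finmap.
From mathcomp Require Import boolp classical_sets functions cardinality.

(** The translation never changes the relation of the model: it records the
    added edges in [B].  By induction on the formula, with [B] and the
    denotation of the nominals arbitrary, truth of the translation in a hybrid
    model amounts to truth of the original formula in the model enriched with
    the edges that [B] denotes; for empty [B] nothing is added.  Rebinding
    nominals that are fresh for [B] does not change those edges. *)

Set Implicit Arguments.
Unset Strict Implicit.
Unset Printing Implicit Defensive.

Local Open Scope classical_set_scope.

Lemma classical_set1_inj (T : Type) (x y : T) : [set x] = [set y] -> x = y.
Proof. by move=> xy; have : [set y] x by rewrite -xy. Qed.

Section HybridSat.
Variables (PROP NOM : choiceType) (W : Type).
Implicit Types (N : hmodel PROP NOM W) (B : {fset NOM * NOM}) (n m : NOM).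

Lemma hsat_or N w a b : hsat N w (HOr a b) <-> hsat N w a \/ hsat N w b.
Proof. by rewrite /= -not_orP notK. Qed.

Lemma hsat_bigor N w (I : eqType) (s : seq I) (F : I -> hform PROP NOM) :
  hsat N w (\big[@HOr PROP NOM/HBot]_(i <- s) F i) <->
  exists2 i, i \in s & hsat N w (F i).
Proof.
elim: s => [|i s IHs]; first by rewrite big_nil; split=> [[]|[]].
rewrite big_cons hsat_or IHs; split=> [[Fi|[j js Fj]]|[j]].
- by exists i; rewrite ?mem_head.
- by exists j; rewrite // in_cons js orbT.
- by rewrite in_cons => /orP[/eqP->|js] Fj; [left|right; exists j].
Qed.

(** The only possible witness of the [HE] inside [HAt] is the state that [n] names, so the
    evaluation state [w] is irrelevant. *)
Lemma hsat_at N n v w a :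
  nom_of N n = [set v] -> hsat N w (HAt n a) <-> hsat N v a.
Proof.
move=> nv /=; split=> [[u []]|va]; last by exists v.
by rewrite nv => vu; rewrite (classical_set1_inj vu).
Qed.

Lemma hsat_at_dia N n m v u w :
  nom_of N n = [set v] -> nom_of N m = [set u] ->
  hsat N w (HAt n (HDia (HNom m))) <-> rel_of N (v, u).
Proof.
move=> nv mu; rewrite (hsat_at _ _ nv) /=.
split=> [[x []]|vu]; last by exists u.
by rewrite mu => vx ux; rewrite (classical_set1_inj ux).
Qed.

(** Nominals denote singleton sets, so naming a state is stated as an equation between sets; no
    denoted state has to be chosen. *)
Definition edges N B : set (W * W) :=
  [set e | exists2 p, p \in B &
    nom_of N p.1 = [set e.1] /\ nom_of N p.2 = [set e.2]].

Definition enriched N B : model PROP W :=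
  Model (rel_of N `|` edges N B) (val_of N).

Lemma edges0 N : edges N fset0 = set0.
Proof. by apply/seteqP; split=> // e []. Qed.

(** Only the source of the edge is passed as a nominal: each disjunct of [belongs] reads the target
    off the current state [w]. *)
Lemma hsat_belongs N B n v w :
  nom_of N n = [set v] -> hsat N w (belongs PROP n B) <-> edges N B (v, w).
Proof.
move=> nv; rewrite /belongs hsat_bigor.
by split=> -[p pB [p1 p2]]; exists p => //; split=> //;
  apply/(hsat_at w (HNom p.1) nv).
Qed.

Lemma enriched_upd N B n w :
  n \notin noms B -> enriched (hmodel_upd N n w) B = enriched N B.
Proof.
rewrite /noms in_fsetU negb_or => /andP[n1 n2]; congr (Model (_ `|` _) _).
have upd1 p : p \in B -> nom_upd (nom_of N) n w p.1 = nom_of N p.1.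
  move=> pB; rewrite /nom_upd; case: eqP => // pn.
  by case/negP: n1; rewrite -pn; apply/imfsetP; exists p.
have upd2 p : p \in B -> nom_upd (nom_of N) n w p.2 = nom_of N p.2.
  move=> pB; rewrite /nom_upd; case: eqP => // pn.
  by case/negP: n2; rewrite -pn; apply/imfsetP; exists p.
by apply/seteqP; split=> e [p pB] /= pe; exists p => //;
  move: pe; rewrite /= upd1 // upd2.
Qed.

(** Links the growth of the parameter in the bridge clauses of the translation to the change of
    model in their semantics. *)
Lemma enriched_add N B n m v u :
  nom_of N n = [set v] -> nom_of N m = [set u] ->
  enriched N (B `|` [fset (n, m)])%fset = add_edge (enriched N B) v u.
Proof.
move=> nv mu; rewrite /add_edge /enriched /= -setUA; congr (Model (_ `|` _) _).
apply/seteqP; split=> [[x y] [p]|[x y] [[p pB pe]|[-> ->]]].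
- rewrite in_fsetU in_fset1 => /orP[pB|/eqP->] /= [p1 p2].
    by left; exists p.
  by right; rewrite /= (classical_set1_inj (etrans (esym nv) p1)) (classical_set1_inj (etrans (esym mu) p2)).
- by exists p; rewrite // in_fsetU pB.
- by exists (n, m); rewrite // in_fsetU in_fset1 eqxx orbT.
Qed.

(** The guard of both bridge clauses. It is evaluated at [u], the state named by [m], because
    [belongs] takes the current state as target. *)
Lemma hsat_new_edge N B n m v u :
  nom_of N n = [set v] -> nom_of N m = [set u] ->
  hsat N u (HAnd (HNeg (HAt n (HDia (HNom m)))) (HNeg (belongs PROP n B)))
  <-> ~ rel_of (enriched N B) (v, u).
Proof.
move=> nv mu; rewrite not_orP -(hsat_at_dia u nv mu).
by rewrite -(hsat_belongs B u nv).
Qed.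

Lemma hsat_old_edge N B n m v u :
  nom_of N n = [set v] -> nom_of N m = [set u] ->
  hsat N u (HOr (HAt n (HDia (HNom m))) (belongs PROP n B)) <->
  rel_of (enriched N B) (v, u).
Proof.
(* By definition of [HOr], the guard of the diamond is the negation of the bridge guard. *)
move=> nv mu; rewrite -[X in _ <-> X]notK -(hsat_new_edge B nv mu).
by [].
Qed.

Lemma nom_upd_eq N n w : nom_of (hmodel_upd N n w) n = [set w].
Proof. by rewrite /= /nom_upd eqxx. Qed.

Lemma nom_upd_neq N n m w :
  m != n -> nom_of (hmodel_upd N n w) m = nom_of N m.
Proof. by rewrite /= /nom_upd => /negbTE ->. Qed.

End HybridSat.

Lemma hsat_translate (PROP NOM : choiceType) (c : naming PROP NOM) (W : Type)
    (phi : bform PROP) (N : hmodel PROP NOM W) (B : {fset NOM * NOM}) (w : W) :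
  hsat N w (translate c B phi) <-> bsat (enriched N B) w phi.
Proof.
elim: phi N B w => [|p|a IHa|a IHa b IHb|a IHa|a IHa|a IHa] N B w.
- by [].
- by [].
- by rewrite /= IHa.
- by rewrite /= IHa IHb.
- have := nm_uniq c B (BDia a); have [] := nm_fresh c B (BDia a).
  rewrite [translate _ _ _]/=.
  move: (nm_n _ _ _) (nm_m _ _ _) (nm_k _ _ _) => n m k nB mB _ /=.
  rewrite !inE negb_or => /andP[/andP[nm _] _].
  (* The model in which the body is evaluated once both binders have been passed. *)
  pose N' v := hmodel_upd (hmodel_upd N n w) m v.
  have nw v : nom_of (N' v) n = [set w] by rewrite nom_upd_neq ?nom_upd_eq.
  have mv v : nom_of (N' v) m = [set v] by rewrite nom_upd_eq.
  have EB v : enriched (N' v) B = enriched N B by rewrite !enriched_upd.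
  have wvE v : hsat (N' v) v _ <-> _ := hsat_old_edge B (nw v) (mv v).
  have aE v := IHa (N' v) B v.
  split=> -[v [wv va]]; exists v; move: (wvE v) (aE v);
    rewrite EB => -[wv1 wv2] [va1 va2].
    by split; [exact: wv1 | exact: va1].
  by split; [exact: wv2 | exact: va2].
- have := nm_uniq c B (BBr a); have [] := nm_fresh c B (BBr a).
  rewrite [translate _ _ _]/=.
  move: (nm_n _ _ _) (nm_m _ _ _) (nm_k _ _ _) => n m k nB mB _ /=.
  rewrite !inE negb_or => /andP[/andP[nm _] _].
  pose N' v := hmodel_upd (hmodel_upd N n w) m v.
  have nw v : nom_of (N' v) n = [set w] by rewrite nom_upd_neq ?nom_upd_eq.
  have mv v : nom_of (N' v) m = [set v] by rewrite nom_upd_eq.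
  have EB v : enriched (N' v) B = enriched N B by rewrite !enriched_upd.
  have wvE v : hsat (N' v) v _ <-> _ := hsat_new_edge B (nw v) (mv v).
  have aE v := IHa (N' v) (B `|` [fset (n, m)])%fset v.
  split=> -[v [wv va]]; exists v; move: (wvE v) (aE v);
    (* The new pair is read in [N' v], where its names are bound; freshness then takes the older
       edges back to [N]. *)
    rewrite (enriched_add B (nw v) (mv v)) EB => -[wv1 wv2] [va1 va2].
    by split; [exact: wv1 | exact: va1].
  by split; [exact: wv2 | exact: va2].
- have := nm_uniq c B (BGbr a); have [] := nm_fresh c B (BGbr a).
  rewrite [translate _ _ _]/=.
  move: (nm_n _ _ _) (nm_m _ _ _) (nm_k _ _ _) => n m k nB mB kB /=.
  rewrite !inE negb_or => /andP[/andP[nm nk] /andP[mk _]].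
  pose N' v u := hmodel_upd (hmodel_upd (hmodel_upd N k w) n v) m u.
  (* Since [k] differs from [n] and [m], it still names the initial state after they are bound. *)
  have kw v u : nom_of (N' v u) k = [set w].
    by do 2!rewrite nom_upd_neq 1?eq_sym //; rewrite nom_upd_eq.
  have nv v u : nom_of (N' v u) n = [set v].
    by rewrite nom_upd_neq ?nom_upd_eq.
  have mu v u : nom_of (N' v u) m = [set u] by rewrite nom_upd_eq.
  have EB v u : enriched (N' v u) B = enriched N B by rewrite !enriched_upd.
  have vuE v u : hsat (N' v u) u _ <-> _ := hsat_new_edge B (nv v u) (mu v u).
  have aE v u := IHa (N' v u) (B `|` [fset (n, m)])%fset w.
  split=> -[v [u [vu wa]]]; exists v, u; move: (vuE v u) (aE v u);
    (* Evaluation has moved to [u]; the operator [HAt k] brings it back to [w], where the induction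
       hypothesis applies. *)
    rewrite -(hsat_at u _ (kw v u)) (enriched_add B (nv v u) (mu v u)) EB;
    move=> [vu1 vu2] [wa1 wa2].
    by split; [exact: vu1 | exact: wa1].
  by split; [exact: vu2 | exact: wa2].
Qed.

Theorem theorem2
  (PROP NOM : choiceType)
  (PROP_inf : countably_infinite PROP)
  (NOM_inf : countably_infinite NOM)
  (c : naming PROP NOM)
  (W : Type) (M : model PROP W) (w : W) (phi : bform PROP)
  (nu : NOM -> set W) (nuP : forall n : NOM, is_singleton (nu n)) :
  bsat M w phi <-> hsat (HModel M nuP) w (translate c fset0 phi).
Proof.
(* Destructing [M] identifies it with the record rebuilt from its two projections. *)
by rewrite hsat_translate /enriched edges0 setU0; case: M.
Qed.
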